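(* Let $n$ and $d$ be positive integers such that $d<n$; let $T$ be any rooted tree on $n$ nodes where each internal node has at most $d$ children and let $T^\ast$ be the full caterpillar of degree $d$ on $n$ nodes. Then $c(T,k)\ge c(T^\ast,k)$ for all $k=1,2,\ldots,n$.
   Context: All rooted trees are finite. A leaf of a rooted tree is a node with no children; an internal node is a node that is not a leaf. A transversal in a rooted tree is any set of nodes that meets every path from the root to a leaf (paths include both the root and the leaf). For a rooted tree $T$, $c(T,k)$ denotes the number of transversals of size $k$ in $T$. A caterpillar is a rooted tree where removal of all leaves produces a rooted tree with precisely one leaf (a single-node rooted tree has precisely one leaf, namely its root); equivalently, the internal nodes form a path descending from the root. A full caterpillar of degree $d$ is a caterpillar where each internal node, except possibly the lowest one, has precisely $d$ children, and the lowest internal node has at most $d$ children. For positive integers $d<n$, the full caterpillar of degree $d$ on $n$ nodes is unique up to isomorphism of rooted trees. *)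

(* Defs.v *)
From mathcomp Require Import all_boot.
From mathcomp Require Import boolp.

Set Implicit Arguments.
Unset Strict Implicit.
Unset Printing Implicit Defensive.

(* The parent function is total: it fixes the root, and this loop is not an
   edge of the tree. [root_reach] rules out cycles and other components. *)
Record rtree := RTree {
  node :> finType;
  root : node;
  parent : node -> node;
  parent_root : parent root = root;
  root_reach : forall v, exists i, iter i parent v = root
}.

Definition child (T : rtree) : rel T :=
  [rel v u | (u != root T) && (parent u == v)].

Definition children (T : rtree) (v : T) : {set T} := [set u | child v u].

Definition leaf (T : rtree) (v : T) : bool := children v == set0.

Definition internal (T : rtree) (v : T) : bool := ~~ leaf v.

(* In mathcomp, [path e x p] says that [x :: p] is a path, from [x] to
   [last x p]. *)
Definition transversal (T : rtree) (S : {set T}) : Prop :=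
  forall p : seq T, path (@child T) (root T) p -> leaf (last (root T) p) ->
    exists2 v, v \in root T :: p & v \in S.

Definition ntransversals (T : rtree) (k : nat) : nat :=
  #|[set S : {set T} | `[< transversal S >] & #|S| == k]|.

(* The nodes that become leaves once all leaves of [T] are removed. *)
Definition pruned_leaves (T : rtree) : {set T} :=
  [set v | internal v & [forall u in children v, leaf u]].

(* A single-node tree is not a caterpillar: removing its leaf leaves no tree. *)
Definition caterpillar (T : rtree) : Prop := #|pruned_leaves T| = 1.

(* The lowest internal node is the unique element of [pruned_leaves T]. *)
Definition full_caterpillar (d : nat) (T : rtree) : Prop :=
  [/\ caterpillar T,
      forall v : T, internal v -> v \notin pruned_leaves T ->
        #|children v| = d
    & forall v : T, v \in pruned_leaves T -> #|children v| <= d].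

(* Main.v *)
From mathcomp Require Import all_boot all_algebra ring zify.
From mathcomp Require Import boolp.
Require Import Defs.

Set Implicit Arguments.
Unset Strict Implicit.
Unset Printing Implicit Defensive.

(** Let P_T be the polynomial whose coefficient of x^j is the number of
    transversals of size j in T, write y for 1 + x, and compare polynomials
    coefficient by coefficient.  Let T have n nodes.  A set of nodes is a
    transversal iff it contains the root, in which case the other nodes are free,
    or the root is not a leaf and the set restricts to a transversal of every
    subtree hanging from the root.  Hence
      P_T = x y^(n-1) + prod_i P_(T_i),
    where the product runs over the child subtrees and is dropped when the root
    is a leaf ([blockpolyE]).

    For the full caterpillar of degree d with m + 1 nodes this recurrence reads
      C_m = x y^m + x^(d-1) C_(m-d)   if m >= d,
      C_m = x y^m + x^m               if 0 < m < d,
      C_0 = x,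
    and this is the family [cater d].  Indexing it by the number m of non-root
    nodes makes two inequalities simple:
    - x C_m <= C_(m+1)             ([cater_shift1]),
    - x C_(a+b) <= C_a C_b         ([cater_merge]).
    Both are inductions along the recurrence.  The second says that fusing two
    caterpillars into one, at the cost of a node that is always taken, creates
    no transversals.

    Suppose now that the root of T has k children, 0 < k <= d, whose subtrees
    have a_i + 1 nodes; then T has m + 1 nodes, m = k + s with s = sum a_i.
    By induction prod P_(T_i) >= prod C_(a_i).  Merging gives
    x prod C_(a_i) >= x^k C_s, and shifting d - k times gives
    x^k C_s >= x^d C_(m-d) when m >= d.  A factor x cancels, which leaves the
    second summand of C_m ([cater_below_le_prod]).  When m < d that summand is
    just x^m, which is below the product because x^(a_i+1) <= C_(a_i).

    In a full caterpillar every internal node except the lowest has exactly one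
    internal child, since each internal node has the lowest one below it and
    siblings have disjoint subtrees.  The recurrence then yields equality
    ([blockpoly_full_caterpillar]). *)

(** * Coefficientwise order on polynomials over the naturals *)

Section Coefficientwise.
Import GRing.Theory.
Local Open Scope ring_scope.

Definition coef_le (p q : {poly nat}) : Prop :=
  forall i, ((p`_i)%R <= (q`_i)%R)%N.
Local Notation "p <=c q" := (coef_le p q) (at level 70).

Lemma coef_le0 p : 0 <=c p.
Proof. by move=> i; rewrite coef0. Qed.

Lemma coef_le_trans q p r : p <=c q -> q <=c r -> p <=c r.
Proof. by move=> pq qr i; apply: leq_trans (pq i) (qr i). Qed.

Lemma coef_leD p q p' q' : p <=c p' -> q <=c q' -> p + q <=c p' + q'.
Proof. by move=> pp qq i; rewrite !coefD leq_add. Qed.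

Lemma coef_le_addl p q : p <=c p + q.
Proof. by move=> i; rewrite coefD leq_addr. Qed.

Lemma coef_le_addr p q : q <=c p + q.
Proof. by move=> i; rewrite coefD leq_addl. Qed.

Lemma coef_leM p q p' q' : p <=c p' -> q <=c q' -> p * q <=c p' * q'.
Proof.
by move=> pp qq i; rewrite !coefM; apply: leq_sum => j _; apply: leq_mul.
Qed.

Lemma coef_leX p q n : p <=c q -> p ^+ n <=c q ^+ n.
Proof.
by move=> pq; elim: n => [|n IHn] //; rewrite !exprS; apply: coef_leM.
Qed.

Lemma coef_le_prod (I : finType) (A : {pred I}) (F G : I -> {poly nat}) :
  (forall i, i \in A -> F i <=c G i) ->
  \prod_(i in A) F i <=c \prod_(i in A) G i.
Proof.
move=> FG; apply: (big_ind2 coef_le) => //.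
by move=> *; apply: coef_leM.
Qed.

(** Multiplication by 'X only shifts coefficients, so it can be cancelled.  This
    lets the product bound below be stated with a factor 'X on one side, which
    makes it hold for an empty product as well. *)
Lemma coef_le_mulX2l p q : 'X * p <=c 'X * q -> p <=c q.
Proof. by move=> pq i; have := pq i.+1; rewrite !coefXM. Qed.

Lemma coef_le_X_exp n : 'X^n <=c (1 + 'X) ^+ n.
Proof. by apply: coef_leX; apply: coef_le_addr. Qed.

Lemma coef_le_mulrb p (b : bool) : p *+ b <=c p.
Proof. by case: b => //; apply: coef_le0. Qed.

(** * Polynomials of the full caterpillars *)

(** [cater_rec d r q] is the polynomial of the full caterpillar of degree [d]
    with [r + q * d] non-root nodes, [r < d]: its [q] topmost internal nodes
    have [d] children each, and the next node down carries [r] leaves. *)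
Fixpoint cater_rec (d r q : nat) : {poly nat} :=
  if q is q'.+1 then
    'X * (1 + 'X) ^+ (r + q * d) + 'X^(d.-1) * cater_rec d r q'
  else 'X * (1 + 'X) ^+ r + 'X^r *+ (0 < r)%N.

(** The index [m] counts the nodes other than the root. *)
Definition cater d m := cater_rec d (m %% d) (m %/ d).

(** The contribution of the transversals that avoid the root.  A lone root is a
    leaf and has none, whence the factor [0 < m]. *)
Definition cater_below d m : {poly nat} :=
  if (m < d)%N then 'X^m *+ (0 < m)%N else 'X^(d.-1) * cater d (m - d).

Lemma caterE d m : (0 < d)%N ->
  cater d m = 'X * (1 + 'X) ^+ m + cater_below d m.
Proof.
move=> d0; rewrite /cater_below; case: ltnP => md.
  by rewrite /cater divn_small // modn_small.
rewrite {1}/cater /cater -{1 2}(subnK md) modnDr divnDr // divnn d0 addn1 /=.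
congr ('X * (1 + 'X) ^+ _ + _).
by rewrite mulSn; have := divn_eq (m - d) d; lia.
Qed.

Lemma cater0 d : (0 < d)%N -> cater d 0 = 'X.
Proof. by move=> d0; rewrite /cater mod0n div0n /= expr0 mulr1 addr0. Qed.

Lemma cater_ge_root d m : (0 < d)%N -> 'X * (1 + 'X) ^+ m <=c cater d m.
Proof. by move=> d0; rewrite caterE //; apply: coef_le_addl. Qed.

(** The two summands of the recurrence compare separately: the first because
    ['X <= 1 + 'X], the second by induction once [m >= d]. *)
Lemma cater_shift1 d m : (0 < d)%N -> 'X * cater d m <=c cater d m.+1.
Proof.
move=> d0; elim/ltn_ind: m => m IHm.
rewrite !caterE // mulrDr; apply: coef_leD.
  apply: coef_leM => //; rewrite exprS; apply: coef_leM => //.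
  exact: coef_le_addr.
rewrite /cater_below; case: (ltngtP m.+1 d) => md.
- case: m {IHm} md => [|m] md; last by rewrite -exprS.
  by rewrite mulr0n mulr0; apply: coef_le0.
- rewrite subSn // mulrCA; apply: coef_leM => //.
  by apply: IHm; lia.
- rewrite -md subnn cater0 // -exprSr.
  case: m {IHm md} => [|m]; last by rewrite -exprS.
  by rewrite mulr0n mulr0; apply: coef_le0.
Qed.

Lemma cater_shift d j m : (0 < d)%N -> 'X^j * cater d m <=c cater d (m + j).
Proof.
move=> d0; elim: j => [|j IHj]; first by rewrite mul1r addn0.
rewrite exprS -mulrA addnS; apply: coef_le_trans (cater_shift1 _ d0).
exact: coef_leM.
Qed.

(** If [d <= a], the recurrence peels off one level of [cater d a] and one of
    [cater d (a + b)]: the terms through the root compare because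
    ['X * (1 + 'X)^b] is below [cater d b], the others by induction.  If both
    indices are smaller than [d], both caterpillars are stars and the product
    is expanded. *)
Lemma cater_merge d a b : (0 < d)%N ->
  'X * cater d (a + b) <=c cater d a * cater d b.
Proof.
move=> d0; have [n] := ubnP (a + b).
elim: n a b => // n IHn a b; rewrite ltnS => leabn.
wlog leba: a b leabn / (b <= a)%N.
  move=> IH; case/orP: (leq_total b a) => [|leab]; first exact: IH.
  by rewrite addnC [cater d a * _]mulrC; apply: IH => //; rewrite addnC.
have [leda|ltad] := leqP d a.
  rewrite (caterE (a + b)) // (caterE a) // mulrDr mulrDl; apply: coef_leD.
    set y : {poly nat} := 1 + 'X.
    have -> : 'X * ('X * y ^+ (a + b))
      = 'X * y ^+ a * ('X * y ^+ b) :> {poly nat} by rewrite exprD; ring.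
    by apply: coef_leM => //; apply: cater_ge_root.
  rewrite /cater_below !ltnNge leda (leq_trans leda (leq_addr _ _)) /=.
  rewrite mulrCA -mulrA; apply: coef_leM => //.
  by rewrite -addnBAC //; apply: IHn; lia.
have ltbd := leq_ltn_trans leba ltad.
have [->|b0] := posnP b; first by rewrite addn0 cater0 // mulrC.
have a0 := leq_trans b0 leba.
rewrite !caterE //; set y : {poly nat} := 1 + 'X.
rewrite {2 3}/cater_below ltad ltbd a0 b0 !mulr1n.
have -> : ('X * y ^+ a + 'X^a) * ('X * y ^+ b + 'X^b)
  = 'X * ('X * y ^+ (a + b))
    + ('X * 'X^a * y ^+ b + ('X^(a + b) + 'X * 'X^b * y ^+ a))
  :> {poly nat} by rewrite !exprD; ring.
rewrite mulrDr; apply: coef_leD => //; rewrite /cater_below addn_gt0 a0 /=.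
case: ltnP => abd.
  rewrite mulr1n exprD mulrA; apply: coef_le_trans (coef_le_addl _ _).
  by apply: coef_leM => //; apply: coef_le_X_exp.
(* One level is completed, and [c] leaves are left for the next star. *)
set c := (a + b - d)%N.
have ltcd : (c < d)%N by lia.
have lecb : (c <= b)%N by lia.
rewrite mulrA -exprS prednK // caterE // /cater_below ltcd mulrDr.
apply: coef_leD; last first.
  apply: coef_le_trans (coef_le_addl _ _).
  have -> : (a + b = d + c)%N by rewrite /c; lia.
  by rewrite exprD; apply: coef_leM => //; apply: coef_le_mulrb.
have -> : 'X^d * ('X * y ^+ c)
    = 'X * 'X^a * ('X^(b - c) * y ^+ c) :> {poly nat}.
  rewrite (_ : d = a + (b - c))%N; last by lia.
  by rewrite exprD; ring.
apply: coef_leM => //; rewrite -[in X in _ <=c X](subnK lecb) exprD.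
by apply: coef_leM => //; apply: coef_le_X_exp.
Qed.

(** The factor 'X on the right makes the bound uniform in the number of factors:
    with none it is an equality, and each further factor costs one merge. *)
Lemma cater_merge_prod (I : finType) (A : {pred I}) d (a : I -> nat) :
  (0 < d)%N ->
  'X^#|A| * cater d (\sum_(i in A) a i) <=c 'X * \prod_(i in A) cater d (a i).
Proof.
move=> d0; rewrite -prodr_const.
apply: (big_rec3 (fun D s (p : {poly nat}) => p * cater d s <=c 'X * D)).
  by rewrite cater0 // mul1r mulr1.
move=> i D s p _ IH; apply: (@coef_le_trans (p * (cater d (a i) * cater d s))).
  rewrite [X in X <=c _](_ : _ = p * ('X * cater d (a i + s))); last by ring.
  by apply: coef_leM => //; apply: cater_merge.
have -> : p * (cater d (a i) * cater d s) = cater d (a i) * (p * cater d s)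
  by ring.
by rewrite (mulrCA 'X); apply: coef_leM.
Qed.

(** The caterpillars hanging from a node are merged into a single one, and
    shifting it [d - #|A|] times makes up for the missing children.  If there
    are fewer than [d] nodes below the root, only the monomial of the full set
    has to be found in the product. *)
Lemma cater_below_le_prod (I : finType) (A : {pred I}) d (a : I -> nat) :
  (0 < #|A|)%N -> (#|A| <= d)%N ->
  cater_below d (\sum_(i in A) (a i).+1) <=c \prod_(i in A) cater d (a i).
Proof.
move=> A0 leAd; have d0 := leq_trans A0 leAd.
have -> : (\sum_(i in A) (a i).+1 = #|A| + \sum_(i in A) a i)%N.
  by rewrite -sum1_card -big_split.
rewrite /cater_below; set s := (\sum_(i in A) a i)%N; case: ltnP => [_|led].
  rewrite addn_gt0 A0 mulr1n exprD -prodr_const -prodrXr -big_split /=.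
  apply: coef_le_prod => i _; apply: coef_le_trans (cater_ge_root _ d0).
  by apply: coef_leM => //; apply: coef_le_X_exp.
apply: coef_le_mulX2l; apply: coef_le_trans (cater_merge_prod _ _ d0).
rewrite mulrA -exprS prednK // -/s.
rewrite -[X in 'X^X * _ <=c _](subnKC leAd) exprD -mulrA.
apply: coef_leM => //.
rewrite [X in _ <=c cater d X](_ : _ = #|A| + s - d + (d - #|A|))%N; last lia.
exact: cater_shift.
Qed.

End Coefficientwise.

(** * Generating functions of families of finite sets *)

Section GeneratingFunction.
Import GRing.Theory.
Local Open Scope ring_scope.

Variable T : finType.
Implicit Types (A B S : {set T}) (F G : pred {set T}).

Definition genfun A F : {poly nat} :=
  \sum_(S : {set T} | (S \subset A) && F S) 'X^#|S|.

Definition depends_on F A := forall S, F S = F (S :&: A).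

Lemma coef_genfun A F k :
  ((genfun A F)`_k)%R = #|[set S : {set T} | (S \subset A) && F S & #|S| == k]|.
Proof.
rewrite /genfun coef_sum -sum1_card.
rewrite (eq_bigr (fun S : {set T} => if #|S| == k then 1%N else 0%N)).
  by rewrite -big_mkcondr /=; apply: eq_bigl => S; rewrite inE.
by move=> S _; rewrite coefXn eq_sym; case: ifP.
Qed.

Lemma eq_genfun A F G :
  (forall S, S \subset A -> F S = G S) -> genfun A F = genfun A G.
Proof.
by move=> FG; apply: eq_bigl => S; case: (boolP (S \subset A)) => // /FG ->.
Qed.

Lemma genfunID A F G :
  genfun A F =
  genfun A (fun S => F S && G S) + genfun A (fun S => F S && ~~ G S).
Proof.
rewrite /genfun (bigID G) /=.
by congr (_ + _); apply: eq_bigl => S; rewrite andbA.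
Qed.

(** A set [S] inside the disjoint union amounts to the pair of its traces on
    [A] and [B], and sizes add up. *)
Lemma genfun_setU A B F G : [disjoint A & B] ->
  depends_on F A -> depends_on G B ->
  genfun (A :|: B) (fun S => F S && G S) = genfun A F * genfun B G.
Proof.
move=> dAB FA GB; rewrite /genfun big_distrlr pair_big /=.
have AB0 : A :&: B = set0 by apply/disjoint_setI0.
rewrite (reindex_onto (fun p : {set T} * {set T} => p.1 :|: p.2)
  (fun S => (S :&: A, S :&: B))) /=; last first.
  by move=> S /andP[/setIidPl SAB _]; rewrite -setIUr.
have key (S1 S2 : {set T}) : S1 \subset A -> S2 \subset B ->
    (S1 :|: S2) :&: A = S1 /\ (S1 :|: S2) :&: B = S2.
  move=> s1 s2; rewrite !setIUl (setIidPl s1) (setIidPl s2); split.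
    have -> : S2 :&: A = set0; last by rewrite setU0.
    by apply/eqP; rewrite -subset0 -AB0 [A :&: B]setIC setSI.
  have -> : S1 :&: B = set0; last by rewrite set0U.
  by apply/eqP; rewrite -subset0 -AB0 setSI.
apply: eq_big => [[S1 S2]|[S1 S2]] /=.
  apply/idP/idP.
    case/andP=> /and3P[_ FS GS] /eqP[e1 e2].
    have s1 : S1 \subset A by rewrite -e1 subsetIr.
    have s2 : S2 \subset B by rewrite -e2 subsetIr.
    by rewrite s1 s2 -{1}e1 -{2}e2 -FA -GB FS GS.
  case/andP=> /andP[s1 FS] /andP[s2 GS]; have [e1 e2] := key _ _ s1 s2.
  by rewrite setUSS //= FA GB e1 e2 FS GS eqxx.
case/andP=> _ /eqP[e1 e2].
have s1 : S1 \subset A by rewrite -e1 subsetIr.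
have s2 : S2 \subset B by rewrite -e2 subsetIr.
rewrite -exprD cardsU (_ : S1 :&: S2 = set0) ?cards0 ?subn0 //.
by apply/eqP; rewrite -subset0 -AB0 setISS.
Qed.

Lemma genfun_set0 : genfun set0 xpredT = 1.
Proof.
rewrite /genfun (big_pred1 set0) ?cards0 ?expr0 // => S.
by rewrite subset0 andbT.
Qed.

Lemma genfun_set1_mem v : genfun [set v] (fun S => v \in S) = 'X.
Proof.
rewrite /genfun (big_pred1 [set v]) ?cards1 ?expr1 // => S.
rewrite subset1 /=; apply/andP/eqP => [[/orP[/eqP//|/eqP->]]|->].
  by rewrite inE.
by rewrite eqxx set11.
Qed.

Lemma genfun_set1_notin v : genfun [set v] (fun S => v \notin S) = 1.
Proof.
rewrite /genfun (big_pred1 set0) ?cards0 ?expr0 // => S.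
rewrite subset1 /=; apply/andP/eqP => [[/orP[/eqP->|/eqP//]]|->].
  by rewrite set11.
by rewrite eqxx orbT inE.
Qed.

Lemma genfun_bigcup (I : finType) (J : {set I}) (A : I -> {set T})
    (F : I -> pred {set T}) :
  {in J &, forall i j, i != j -> [disjoint A i & A j]} ->
  (forall i, i \in J -> depends_on (F i) (A i)) ->
  genfun (\bigcup_(i in J) A i) (fun S => [forall i in J, F i S])
  = \prod_(i in J) genfun (A i) (F i).
Proof.
have [n] := ubnP #|J|; elim: n J => // n IHn J; rewrite ltnS => leJ disA FA.
have [->|[i iJ]] := set_0Vmem J.
  rewrite !big_set0 -genfun_set0; apply: eq_genfun => S _.
  by apply/forall_inP => i; rewrite inE.
have sJ : {subset J :\ i <= J} by move=> j /setD1P[].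
rewrite (big_setD1 i iJ) (big_setD1 i iJ) /= -IHn; last first.
- by move=> j /sJ; apply: FA.
- by move=> j k /sJ jJ /sJ kJ; apply: disA.
- by apply: leq_trans leJ; rewrite [X in (_ < X)%N](cardsD1 i) iJ.
rewrite -genfun_setU; last 3 first.
- rewrite bigcup_disjoint // => j /setD1P[ji jJ]; apply: disA => //.
  by rewrite eq_sym.
- exact: FA.
- move=> S; apply: eq_forallb_in => j jJ; rewrite FA ?sJ // [RHS]FA ?sJ //.
  by congr (F j _); rewrite -setIA (setIidPr (bigcup_sup j jJ)).
apply: eq_genfun => S _; apply/forall_inP/andP => [FS|[FiS /forall_inP FS] j jJ].
  by split; [apply: FS | apply/forall_inP => j /sJ; apply: FS].
by have [->//|ji] := eqVneq j i; apply: FS; rewrite !inE ji.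
Qed.

(** The binomial theorem for the subsets of [A], read off from the partition of
    [A] into singletons. *)
Lemma genfunT A : genfun A xpredT = (1 + 'X) ^+ #|A|.
Proof.
rewrite -prodr_const (eq_bigr (fun v => genfun [set v] xpredT)); last first.
  move=> v _; rewrite (genfunID _ _ (fun S => v \in S)) /= addrC.
  by rewrite genfun_set1_mem genfun_set1_notin.
rewrite -genfun_bigcup //; last first.
  by move=> v w _ _ vw; rewrite disjoints1 inE.
rewrite -[A in LHS](_ : \bigcup_(v in A) [set v] = A).
  by apply: eq_genfun => S _; apply/esym/forall_inP.
apply/setP => v; apply/bigcupP/idP => [[w wA /set1P->]//|vA].
by exists v; rewrite ?set11.
Qed.

End GeneratingFunction.

(** * Subtrees of a rooted tree *)

Section Subtrees.
Import GRing.Theory.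
Local Open Scope ring_scope.

Variable T : rtree.
Implicit Types (u v w : T) (S : {set T}).

Definition subtree v : {set T} := [set u | connect (@child T) v u].

Lemma mem_subtree v : v \in subtree v.
Proof. by rewrite inE connect0. Qed.

Lemma iter_parent_of_subtree v u :
  u \in subtree v -> exists i, iter i (@parent T) u = v.
Proof.
rewrite inE => /connectP[p].
elim: p v => [|w p IHp] v /=; first by move=> _ ->; exists 0%N.
case/andP=> /andP[_ /eqP pwv] /IHp{}IHp /IHp[i uw].
by exists i.+1; rewrite iterS uw.
Qed.

(** A node on a cycle of [parent] is reached again after arbitrarily many steps,
    while enough steps lead to the root, where [parent] stays. *)
Lemma parent_acyclic v i : iter i.+1 (@parent T) v = v -> v = root T.
Proof.
move=> cyc; have [j vroot] := root_reach v.
have iter_root m : iter m (@parent T) (root T) = root T.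
  by elim: m => //= m ->; apply: parent_root.
have itercyc m : iter (m * i.+1) (@parent T) v = v.
  by elim: m => // m IHm; rewrite mulSn iterD IHm.
by rewrite -(itercyc j) mulnC mulSn addnC iterD vroot iter_root.
Qed.

Lemma subtree_root : subtree (root T) = setT.
Proof.
apply/setP => v; rewrite in_setT; have [i] := root_reach v.
elim: i v => [|i IHi] v; first by move=> /= ->; apply: mem_subtree.
rewrite iterSr => /IHi; have [->|vr] := eqVneq v (root T).
  by rewrite parent_root.
rewrite !inE => /connect_trans; apply; apply: connect1.
by rewrite /child /= vr eqxx.
Qed.

Lemma subtreeE v : subtree v = v |: \bigcup_(u in children v) subtree u.
Proof.
apply/setP => w; rewrite !inE; apply/idP/idP.
  case/connectP=> [[|u p]] /=; first by move=> _ ->; rewrite eqxx.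
  case/andP=> vu pth ->; apply/orP; right.
  by apply/bigcupP; exists u; rewrite !inE //; apply/connectP; exists p.
case/orP=> [/eqP->//|/bigcupP[u]]; rewrite !inE => vu.
by apply: connect_trans; apply: connect1.
Qed.

Lemma parent_notin_subtree v u : child v u -> v \notin subtree u.
Proof.
case/andP=> ur /eqP puv; apply: contra ur => /iter_parent_of_subtree[i vu].
have ir : iter i.+1 (@parent T) u = u by rewrite iterSr puv.
by rewrite -(parent_acyclic ir).
Qed.

(** If a node lies below both siblings, the siblings are at different heights
    above it, so one of them is an ancestor of the other through their common
    parent, which closes a cycle. *)
Lemma disjoint_siblings v u1 u2 :
  child v u1 -> child v u2 -> u1 != u2 -> [disjoint subtree u1 & subtree u2].
Proof.
move=> vu1 vu2 u12; apply/pred0P => w /=; apply/negP => /andP[].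
move=> /iter_parent_of_subtree[i wu1] /iter_parent_of_subtree[j wu2].
wlog ltij : u1 u2 vu1 vu2 u12 i j wu1 wu2 / (i < j)%N.
  move=> IH; case: (ltngtP i j) => [|| eij]; first exact: (IH u1 u2).
    by apply: (IH u2 u1) => //; rewrite eq_sym.
  by move: u12; rewrite -wu1 -wu2 eij eqxx.
move: wu2; rewrite -(subnK ltij) addnS -addSn iterD wu1.
case/andP: (vu1) => _ /eqP pu1; rewrite iterSr pu1 => vu2'.
case/andP: (vu2) => /negP u2r /eqP pu2; apply: u2r; apply/eqP.
by apply: (@parent_acyclic u2 (j - i.+1)); rewrite iterSr pu2.
Qed.

Lemma disjoint_below v :
  [disjoint [set v] & \bigcup_(u in children v) subtree u].
Proof.
rewrite disjoints1; apply/bigcupP => [[u]]; rewrite inE => /parent_notin_subtree.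
by move=> /negP.
Qed.

Lemma disjoint_children v :
  {in children v &, forall u1 u2, u1 != u2 ->
     [disjoint subtree u1 & subtree u2]}.
Proof. by move=> u1 u2; rewrite !inE; apply: disjoint_siblings. Qed.

Definition size_below v := #|\bigcup_(u in children v) subtree u|.

Lemma card_subtree v : #|subtree v| = (size_below v).+1.
Proof.
by rewrite subtreeE cardsU1 (disjointFr (disjoint_below v)) ?set11.
Qed.

Lemma size_belowE v :
  size_below v = (\sum_(u in children v) (size_below u).+1)%N.
Proof.
rewrite /size_below big_mkcond -sum1_card.
rewrite partition_disjoint_bigcup => [|u1 u2 u12].
  rewrite [RHS]big_mkcond; apply: eq_bigr => u _.
  by case: ifP => _; rewrite ?big_set0 // sum1_card card_subtree.
case: ifP => [c1|_]; last by rewrite -setI_eq0 set0I.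
case: ifP => [c2|_]; last by rewrite -setI_eq0 setI0.
exact: disjoint_children c2 u12.
Qed.

(** * The transversal polynomial of a subtree *)

Definition blocks S v : bool :=
  `[< forall p, path (@child T) v p -> leaf (last v p) ->
        exists2 w, w \in v :: p & w \in S >].

Lemma blocksE S v :
  blocks S v = (v \in S) || internal v && [forall u in children v, blocks S u].
Proof.
apply/asboolP/idP => [bl|].
  case: (boolP (v \in S)) => //= vS; apply/andP; split.
    apply/negP => vleaf; case: (bl [::] isT vleaf) => w; rewrite inE => /eqP->.
    by rewrite (negPf vS).
  apply/forall_inP => u; rewrite inE => vu; apply/asboolP => p pth lf.
  have [||w] := bl (u :: p); rewrite /= ?vu //.
  by rewrite inE => /orP[/eqP->|wp wS]; [rewrite (negPf vS) | exists w].
case/orP=> [vS p _ _|/andP[vint /forall_inP bl]].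
  by exists v; rewrite ?mem_head.
case=> [_ /= vleaf|u p /andP[vu pth] lf].
  by rewrite /internal vleaf in vint.
have /asboolP/(_ p pth lf)[w wp wS] : blocks S u by apply: bl; rewrite inE.
by exists w; rewrite // inE wp orbT.
Qed.

Lemma blocks_depends v : depends_on (blocks ^~ v) (subtree v).
Proof.
move=> S; apply/asboolP/asboolP => bl p pth lf;
  have [w wp] := bl p pth lf; last by rewrite inE => /andP[wS _]; exists w.
move=> wS; exists w; rewrite // !inE wS /=.
by apply: (path_connect pth).
Qed.

Definition blockpoly v : {poly nat} := genfun (subtree v) (blocks ^~ v).

(** Sets that contain [v] are free below [v].  Sets that avoid [v] must block
    every child, and these conditions concern disjoint subtrees. *)
Lemma blockpolyE v :
  blockpoly v = 'X * (1 + 'X) ^+ size_below v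
    + (\prod_(u in children v) blockpoly u) *+ internal v.
Proof.
rewrite /blockpoly (genfunID _ _ (fun S => v \in S)).
rewrite subtreeE; congr (_ + _).
  rewrite (_ : genfun _ _ =
    genfun ([set v] :|: \bigcup_(u in children v) subtree u)
      (fun S => (v \in S) && true)).
    rewrite genfun_setU ?genfun_set1_mem ?genfunT //.
      exact: disjoint_below.
    by move=> S; rewrite !inE eqxx andbT.
  apply: eq_genfun => S _; rewrite blocksE andbT.
  by case: (v \in S); rewrite ?andbF.
rewrite -genfun_bigcup; last 2 first.
- exact: disjoint_children.
- by move=> u _; apply: blocks_depends.
case: (boolP (internal v)) => vint; last first.
  rewrite mulr0n; apply: big_pred0 => S; rewrite blocksE (negPf vint).
  by rewrite orbF andbN andbF.
rewrite mulr1n -[RHS]mul1r -(genfun_set1_notin v) -genfun_setU.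
- apply: eq_genfun => S _; rewrite blocksE vint.
  by case: (v \in S); rewrite ?andbF ?andbT.
- exact: disjoint_below.
- by move=> S; rewrite !inE eqxx andbT.
move=> S; apply: eq_forallb_in => u uv; rewrite blocks_depends [RHS]blocks_depends.
by rewrite -setIA (setIidPr (bigcup_sup u uv)).
Qed.

Lemma coef_blockpoly_root k : ((blockpoly (root T))`_k)%R = ntransversals T k.
Proof.
rewrite coef_genfun subtree_root /ntransversals; apply: eq_card => S.
by rewrite !inE subsetT.
Qed.

Lemma size_below_child_lt v u : u \in children v -> (size_below u < size_below v)%N.
Proof.
by move=> uv; rewrite -card_subtree; apply/subset_leq_card/bigcup_sup.
Qed.

Lemma children_gt0 v : internal v -> (0 < #|children v|)%N.
Proof. by rewrite /internal /leaf card_gt0. Qed.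

Lemma size_below_leaf v : leaf v -> size_below v = 0%N.
Proof. by rewrite size_belowE /leaf => /eqP->; rewrite big_set0. Qed.

Lemma blockpoly_leaf v : leaf v -> blockpoly v = 'X.
Proof.
by move=> vl; rewrite blockpolyE /internal vl size_below_leaf // expr0 mulr1 addr0.
Qed.

(** * Comparison with the caterpillar *)

Lemma cater_le_blockpoly d v : (0 < d)%N ->
  (forall v, internal v -> #|children v| <= d)%N ->
  coef_le (cater d (size_below v)) (blockpoly v).
Proof.
move=> d0 deg; have [n] := ubnP (size_below v).
elim: n v => // n IHn v; rewrite ltnS => len.
case: (boolP (leaf v)) => [vl|vint].
  by rewrite blockpoly_leaf // size_below_leaf // cater0.
rewrite blockpolyE caterE // [internal v]vint mulr1n; apply: coef_leD => //.
rewrite size_belowE.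
apply: (@coef_le_trans (\prod_(u in children v) cater d (size_below u))).
  by apply: cater_below_le_prod; [apply: children_gt0 | apply: deg].
apply: coef_le_prod => u uv; apply: IHn.
exact: leq_trans (size_below_child_lt uv) len.
Qed.

(** Descending through internal children ends at a node all of whose children
    are leaves. *)
Lemma pruned_leaf_below v : internal v ->
  exists2 w, w \in pruned_leaves T & w \in subtree v.
Proof.
have [n] := ubnP (size_below v).
elim: n v => // n IHn v; rewrite ltnS => len vint.
case: (boolP [forall u in children v, leaf u]) => [lf|].
  by exists v; rewrite ?mem_subtree // inE vint lf.
case/forall_inPn=> u uv uint; have [|//|w wp wu] := IHn u.
  exact: leq_trans (size_below_child_lt uv) len.
exists w => //; rewrite subtreeE inE; apply/orP; right.
by apply/bigcupP; exists u.
Qed.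

(** The identity holds at every node, since the part below a node of a full
    caterpillar is again a full caterpillar or a leaf. *)
Lemma blockpoly_full_caterpillar d v : (0 < d)%N -> full_caterpillar d T ->
  blockpoly v = cater d (size_below v).
Proof.
move=> d0 [/eqP/cards1P[q pq] deg lowdeg]; have [n] := ubnP (size_below v).
elim: n v => // n IHn v; rewrite ltnS => len.
case: (boolP (leaf v)) => [vl|vint].
  by rewrite blockpoly_leaf // size_below_leaf // cater0.
rewrite blockpolyE caterE // [internal v]vint mulr1n; congr (_ + _).
case: (boolP (v \in pruned_leaves T)) => [vp|vp].
  have vc := lowdeg v vp.
  have /forall_inP lf : [forall u in children v, leaf u].
    by move: vp; rewrite inE => /andP[].
  have sz : size_below v = #|children v|.
    rewrite size_belowE -sum1_card; apply: eq_bigr => u /lf ul.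
    by rewrite size_below_leaf.
  rewrite (eq_bigr (fun=> 'X)); last by move=> u /lf; apply: blockpoly_leaf.
  rewrite prodr_const sz /cater_below children_gt0 // mulr1n.
  case: ltnP => // dc.
  have -> : #|children v| = d by apply/eqP; rewrite eqn_leq vc.
  by rewrite subnn cater0 // -exprSr prednK.
(* Above the lowest internal node there is exactly one internal child. *)
have [u uv uint] : exists2 u, u \in children v & ~~ leaf u.
  by move: vp; rewrite inE [internal v]vint /= => /forall_inPn[u uv ul]; exists u.
have lf w : w \in children v :\ u -> leaf w.
  rewrite in_setD1 => /andP[wu wv]; apply: contraT => wint.
  have [q1] := pruned_leaf_below wint; have [q2] := pruned_leaf_below uint.
  rewrite pq => /set1P-> qu /set1P-> qw.
  by have := disjointFr (disjoint_children wv uv wu) qw; rewrite qu.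
have cd : #|children v :\ u| = d.-1.
  by have := deg v vint vp; rewrite (cardsD1 u) uv => <-.
have sz : size_below v = (d + size_below u)%N.
  rewrite size_belowE (big_setD1 u) //= (eq_bigr (fun=> 1%N)).
    by rewrite sum1_card cd; lia.
  by move=> w /lf/size_below_leaf->.
rewrite (big_setD1 u) //= (eq_bigr (fun=> 'X)); last first.
  by move=> w /lf/blockpoly_leaf.
rewrite prodr_const cd mulrC sz /cater_below ltnNge leq_addr /= addKn IHn //.
exact: leq_trans (size_below_child_lt uv) len.
Qed.

End Subtrees.

Theorem theorem1 (n d : nat) (hd : 0 < d) (hdn : d < n)
    (T : rtree) (hTn : #|T| = n)
    (hTd : forall v : T, internal v -> #|children v| <= d)
    (Tstar : rtree) (hSn : #|Tstar| = n) (hSd : full_caterpillar d Tstar)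
    (k : nat) (hk : 1 <= k <= n) :
  ntransversals Tstar k <= ntransversals T k.
Proof.
have sizeE (T' : rtree) : #|T'| = (size_below (root T')).+1.
  by rewrite -card_subtree subtree_root cardsT.
have same : size_below (root Tstar) = size_below (root T).
  by apply: succn_inj; rewrite -!sizeE hSn hTn.
rewrite -!coef_blockpoly_root (blockpoly_full_caterpillar _ hd hSd) same.
exact: cater_le_blockpoly.
Qed.
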